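(* Let $n \ge 1$, let $p(x) = p(x_1,\ldots,x_n)$ be a (not necessarily homogeneous) real stable polynomial in $n$ variables with non-negative real coefficients, and fix any $\kappa \in \mathbb{Z}^n$ with non-negative entries. If $p(\mathbf{1}) = 1$ and $\|\kappa - \nabla p(\mathbf{1})\|_1 < 1$, then \[ \inf_{x_1,\ldots,x_n > 0} \frac{p(x)}{x_1^{\kappa_1} \cdots x_n^{\kappa_n}} \geq \left(1 - \|\kappa - \nabla p(\mathbf{1})\|_1\right)^n . \]
   Context: $\mathbf{1}$ denotes the all-ones vector in $\mathbb{R}^n$, and $\|v\|_1 = \sum_i |v_i|$. A polynomial $p$ with non-negative real coefficients is real stable if $p(x_1,\ldots,x_n) \neq 0$ whenever $x_1,\ldots,x_n$ all lie in the open complex upper half-plane. *)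

(* Defs.v *)
From HB Require Import structures.
From mathcomp Require Import all_boot all_order all_algebra.
From mathcomp Require Import classical_sets reals.
From mathcomp Require Import complex.
From mathcomp Require Import mpoly.

Set Implicit Arguments.
Unset Strict Implicit.
Unset Printing Implicit Defensive.

Import Order.TTheory GRing.Theory Num.Theory.
Local Open Scope ring_scope.
Local Open Scope complex_scope.

Definition real_stable (R : realType) (n : nat) (p : {mpoly R[n]}) : Prop :=
  forall z : 'I_n -> R[i],
    (forall i, 0 < complex.Im (z i)) ->
    (map_mpoly (real_complex R) p).@[z] != 0.

Definition gradient (R : realType) (n : nat) (p : {mpoly R[n]})
    (x : 'I_n -> R) : 'I_n -> R :=
  fun i => (p^`M(i)).@[x].

Definition norm1 (R : realType) (n : nat) (v : 'I_n -> R) : R :=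
  \sum_(i < n) `|v i|.

Definition all_ones (R : realType) (n : nat) : 'I_n -> R := fun=> 1.
Arguments all_ones {R n}.

(* Main.v *)
Require Import Defs.
From HB Require Import structures.
From mathcomp Require Import all_boot all_order all_algebra.
From mathcomp Require Import classical_sets reals.
From mathcomp Require Import complex polyrcf.
From mathcomp Require Import ring lra.
From mathcomp Require Import mpoly.

Set Implicit Arguments.
Unset Strict Implicit.
Unset Printing Implicit Defensive.

Import Order.TTheory GRing.Theory Num.Theory.
Local Open Scope ring_scope.

(* The coefficients of p are the law of a random exponent X with mean grad p(1),
   and p(x) / x^kappa is the expectation of x^(X - kappa). Peel x
   off one level set at a time: if U is the set of coordinates above 1 and c their
   minimum, dividing by c on U leaves fewer coordinates different from 1, and
   undoing this division multiplies p by at least (1 - delta) c^K, where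
   K = kappa(U) and delta = ||kappa - grad p(1)||_1 (coordinates below 1 are
   treated alike). For this last step the restriction of p to the curve c |-> c x
   on U is real rooted, hence a product of factors 1 + a (c - 1), 0 <= a <= 1,
   whose minimum for a given mean m + f (m an integer, 0 <= f <= 1) is
   c^m (1 + f (c - 1)). The mean of |X| on U is controlled because it only grows
   when coordinates in U increase and coordinates outside U decrease: this is
   the negative correlation p p_ij <= p_i p_j of stable polynomials, together
   with its analogue for the homogenizing variable. *)

(** * Real polynomials in one variable: signs, monotonicity, product bounds *)

Section RealPolynomials.
Variable R : rcfType.
Implicit Types (p N D : {poly R}).

(** Continuity at 0; it lets a perturbation parameter tend to 0 in a polynomial inequality. *)
Lemma horner_ge0_right_limit p (e : R) :
  0 < e -> (forall t, 0 < t < e -> 0 <= p.[t]) -> 0 <= p.[0].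
Proof.
move=> e0 pge0; rewrite leNgt; apply/negP => p0.
have Np0 : 0 < - p.[0] by rewrite oppr_gt0.
have [d d0 dP] := poly_cont 0 p Np0.
pose t := Num.min e d / 2.
have m0 : 0 < Num.min e d by rewrite lt_min e0 d0.
have t0 : 0 < t by rewrite /t; lra.
have te : t < e.
  by apply: (lt_le_trans (y := Num.min e d)); [rewrite /t; lra|rewrite ge_min lexx].
have td : t < d.
  by apply: (lt_le_trans (y := Num.min e d)); [rewrite /t; lra|rewrite ge_min lexx orbT].
have := dP t; rewrite subr0 gtr0_norm // => /(_ td).
have := pge0 t; rewrite t0 te => /(_ isT) pt.
by rewrite ger0_norm; lra.
Qed.

(** If [p.[b] < 0], take the last root [r] before [b]: the cofactor of ['X - r] is positive at [r]
    and negative at [b], which forces a later root. *)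
Lemma poly_ge0_of_deriv_root_gt0 p (a b : R) : a <= b -> 0 <= p.[a] ->
  (forall c, a <= c < b -> p.[c] = 0 -> 0 < p^`().[c]) -> 0 <= p.[b].
Proof.
rewrite le_eqVlt => /orP[/eqP-> //|ltab] pa0 dp_gt0; rewrite leNgt; apply/negP => pb0.
have pN0 : p != 0 by apply/eqP => p0; rewrite p0 horner0 ltxx in pb0.
have [r [rab pr0 noroot]] : exists r, [/\ a <= r < b,
    p.[r] = 0 & {in `]r, b[, forall z, ~~ root p z}].
  case: (prev_rootP p a b) => [/eqP|y _ py yab noroot|c _ _ noroot].
  - by rewrite (negPf pN0).
  - by exists y; split; rewrite ?(itvP yab) ?ltW ?(itvP yab).
  exists a; split=> //; first by rewrite lexx.
  move: pa0; rewrite le_eqVlt => /orP[/eqP<- //|pa0].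
  have pab : p.[a] * p.[b] < 0 by rewrite pmulr_rlt0.
  have [z zab] := poly_ivtoo (ltW ltab) pab.
  by rewrite (negPf (noroot z zab)).
have /factor_theorem[q qE] : root p r by apply/rootP.
have /andP[_ rb] := rab.
have dpr : p^`().[r] = q.[r].
  by rewrite qE derivM derivXsubC !hornerE; ring.
have qr : 0 < q.[r] by rewrite -dpr; apply: dp_gt0.
have qb : q.[b] < 0.
  move: pb0; rewrite qE !hornerE; rewrite pmulr_llt0 //; lra.
have qrb : q.[r] * q.[b] < 0 by rewrite pmulr_rlt0.
have [z zrb /eqP qz] := poly_ivtoo (ltW rb) qrb.
by move: (noroot z zrb); rewrite rootE qE !hornerE qz mul0r eqxx.
Qed.

Lemma quotient_nondecreasing N D (a b : R) : a <= b ->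
  (forall c, a <= c <= b -> 0 < D.[c]) ->
  (forall c, a <= c <= b -> 0 <= N^`().[c] * D.[c] - N.[c] * D^`().[c]) ->
  N.[a] * D.[b] <= N.[b] * D.[a].
Proof.
move=> leab D0 W0; have Da : 0 < D.[a] by apply: D0; rewrite lexx leab.
have Db : 0 < D.[b] by apply: D0; rewrite lexx leab.
(* [g.[e]] is [M.[b]] below: adding slope [e] to [N / D] makes its derivative strictly positive, as
   the root criterion demands. *)
pose g := (N.[b] * D.[a] - N.[a] * D.[b])%:P + ((b - a) * D.[a] * D.[b]) *: 'X.
suff : 0 <= g.[0] by rewrite !hornerE subr_ge0.
apply: (@horner_ge0_right_limit _ 1) => // e /andP[e0 _].
pose M := (N + e *: ('X - a%:P) * D) * D.[a]%:P - N.[a] *: D.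
have -> : g.[e] = M.[b] by rewrite /M /g !hornerE; ring.
apply: (@poly_ge0_of_deriv_root_gt0 _ a) => // [|c /andP[ac cb]].
  by rewrite /M !hornerE subrr !(mulr0, mul0r, addr0) subrr.
have cab : a <= c <= b by rewrite ac ltW.
rewrite /M !derivE !hornerE => Mc0.
have := W0 c cab; have Dc := D0 c cab.
set x := (X in 0 < X).
suff xE : x * D.[c] = D.[a] * ((N^`().[c] * D.[c] - N.[c] * D^`().[c]) + e * D.[c] ^+ 2).
  move=> Wc; rewrite -(pmulr_lgt0 _ Dc) xE mulr_gt0 // ltr_wpDl // mulr_gt0 // exprn_gt0 //.
have {Mc0} NE : N.[a] * D.[c] = (N.[c] + e * (c - a) * D.[c]) * D.[a] by move: Mc0; lra.
rewrite /x.
transitivity ((N^`().[c] + (e * D.[c] + e * (c - a) * D^`().[c])) * D.[a] * D.[c]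
    - D^`().[c] * (N.[a] * D.[c])); first by rewrite /=; ring.
by rewrite NE; ring.
Qed.

Lemma prod_nonpos_roots_gt0 (rs : seq R) :
  all (fun r => r <= 0) rs -> 0 < (\prod_(r <- rs) ('X - r%:P)).[1].
Proof.
move=> rs0; rewrite horner_prod big_seq; apply: prodr_gt0 => z /(allP rs0) z0.
by rewrite hornerXsubC; lra.
Qed.

(* The extremal case in the conclusion is [m] factors [c] and one factor
   [1 + f (c - 1)]: the product is log-concave and symmetric in the slopes of
   its factors. *)
Lemma prod_nonpos_roots_ge (rs : seq R) (P := \prod_(r <- rs) ('X - r%:P)) :
  all (fun r => r <= 0) rs ->
  exists m : nat, exists2 f : R, 0 <= f <= 1 &
    P^`().[1] = (m%:R + f) * P.[1] /\
    forall c, 0 <= c -> P.[1] * (c ^+ m * (1 + f * (c - 1))) <= P.[c].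
Proof.
rewrite {}/P; elim: rs => [_|r rs IH /= /andP[r0 rs0]].
  exists 0%N, 0; rewrite ?lexx ?ler01 // !big_nil derivC !hornerE; split=> // c _.
  by rewrite !hornerE.
have [m [f /andP[f0 f1] [dP leP]]] := IH rs0.
rewrite big_cons; set P := \prod_(_ <- _) _ in dP leP *.
have P1 : 0 <= P.[1] by rewrite ltW // prod_nonpos_roots_gt0.
pose a := (1 - r)^-1.
have aE : (1 - r) * a = 1 by rewrite /a mulfV //; apply/eqP; lra.
have a0 : 0 <= a by rewrite /a invr_ge0; lra.
have a1 : a <= 1 by rewrite /a; rewrite invf_le1; lra.
have facE c : c - r = (1 - r) * (1 + a * (c - 1)).
  by rewrite mulrDr mulrA aE; ring.
have dE : (('X - r%:P) * P)^`().[1] = (m%:R + f + a) * ((1 - r) * P.[1]).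
  rewrite derivM derivXsubC !hornerE dP /=.
  by rewrite -[X in X + _]mul1r -[X in X * _ + _]aE; ring.
have step g k : (forall c, 0 <= c -> c ^+ k * (1 + g * (c - 1)) <=
      (1 + a * (c - 1)) * (c ^+ m * (1 + f * (c - 1)))) ->
    forall c, 0 <= c -> (('X - r%:P) * P).[1] * (c ^+ k * (1 + g * (c - 1)))
      <= (('X - r%:P) * P).[c].
  move=> le_g c c0; rewrite !hornerM !hornerXsubC [c - r]facE.
  have r1 : 0 <= 1 - r by lra.
  apply: (@le_trans _ _ ((1 - r) * (P.[1] * ((1 + a * (c - 1)) *
      (c ^+ m * (1 + f * (c - 1))))))).
    by rewrite -mulrA ler_wpM2l // ler_wpM2l // le_g.
  rewrite -mulrA ler_wpM2l // mulrCA ler_wpM2l ?leP //; nra.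
(* The fractional slopes [f] and [a] merge into one, or into a full factor [c] and a remainder
   [f + a - 1]; either way the product drops by a nonnegative multiple of [(c - 1) ^+ 2]. *)
have [af1|af1] := lerP (f + a) 1.
  exists m, (f + a); first by rewrite af1 andbT addr_ge0.
  split; first by rewrite dE !hornerE; ring.
  apply: step => c c0; rewrite mulrCA ler_wpM2l ?exprn_ge0 //.
  rewrite -subr_ge0 (_ : _ - _ = a * f * (c - 1) ^+ 2); last by ring.
  by apply: mulr_ge0; [exact: mulr_ge0|exact: sqr_ge0].
exists m.+1, (f + a - 1); first by lra.
split; first by rewrite dE hornerM hornerXsubC -(natr1 m); ring.
apply: step => c c0; rewrite exprSr -mulrA [X in _ <= X]mulrCA ler_wpM2l ?exprn_ge0 //.
rewrite -subr_ge0 (_ : _ - _ = (1 - a) * (1 - f) * (c - 1) ^+ 2); last by ring.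
by apply: mulr_ge0; [apply: mulr_ge0; lra|exact: sqr_ge0].
Qed.

(** As [d < 1], one integer is critical on each side: [K = m.+1] with [1 - d <= f] when [1 <= c],
    and [K = m] with [f <= d] when [c <= 1]. Other [K] are impossible or settled by comparing powers
    of [c]. *)
Lemma near_integer_power_ge (m K : nat) (f d c : R) :
  0 <= f <= 1 -> 0 <= d < 1 -> 0 < c ->
  (1 <= c /\ K%:R - d <= m%:R + f) \/ (c <= 1 /\ m%:R + f <= K%:R + d) ->
  (1 - d) * c ^+ K <= c ^+ m * (1 + f * (c - 1)).
Proof.
move=> /andP[f0 f1] /andP[d0 d1] c0 cond.
have fc0 : 0 <= 1 + f * (c - 1) by nra.
case: cond => -[c1 slope].
- have [leKm|ltmK] := leqP K m.
    apply: (@le_trans _ _ (c ^+ m)).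
      apply: (@le_trans _ _ (c ^+ K)); last exact: ler_weXn2l.
      by rewrite ler_piMl ?exprn_ge0 ?(ltW c0) //; lra.
    by rewrite ler_peMr ?exprn_ge0 ?(ltW c0) //; nra.
  have KE : K = m.+1.
    apply/eqP; rewrite eqn_leq ltmK andbT leqNgt; apply/negP => ltmK2.
    have : (m.+2%:R : R) <= K%:R by rewrite ler_nat.
    by rewrite -!natr1; lra.
  move: slope; rewrite KE -natr1 exprSr mulrCA => slope.
  by rewrite ler_wpM2l ?exprn_ge0 ?(ltW c0) //; nra.
- have [leKm|ltmK] := leqP K m; last first.
    apply: (@le_trans _ _ (c ^+ m.+1)); last first.
      by rewrite exprSr ler_wpM2l ?exprn_ge0 ?(ltW c0) //; nra.
    apply: (@le_trans _ _ (c ^+ K)); last by rewrite ler_wiXn2l ?(ltW c0).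
    by rewrite ler_piMl ?exprn_ge0 ?(ltW c0) //; lra.
  have KE : K = m.
    apply/eqP; rewrite eqn_leq leKm leqNgt; apply/negP => ltKm.
    have : (K.+1%:R : R) <= m%:R by rewrite ler_nat.
    by rewrite -natr1; lra.
  move: slope; rewrite KE mulrC => slope.
  by rewrite ler_wpM2l ?exprn_ge0 ?(ltW c0) //; nra.
Qed.
End RealPolynomials.

(** * From the location of complex roots to the sign of a Wronskian *)

Section ComplexPolynomials.
Local Open Scope complex_scope.
Variable R : rcfType.
Local Notation C := R[i].
Local Notation toC := (real_complex R).
Local Notation Im := (@complex.Im R).

(* [Im (g'(z) / g(z)) <= 0] is the sum over the roots [r] of
   [Im (1 / (z - r)) <= 0]; multiplying by [|g(z)|^2] avoids the division. *)
Lemma Im_logderiv_le0 (g : {poly C}) (z : C) :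
  (forall r, root g r -> Im r <= Im z) -> Im (g^`().[z] * (g.[z])^*) <= 0.
Proof.
have [->|gN0] := eqVneq g 0; first by rewrite deriv0 horner0 mul0r /= lexx.
have [rs gE] := closed_field_poly_normal g => rootg.
have : forall r, r \in rs -> Im r <= Im z.
  move=> r rrs; apply: rootg; rewrite gE rootZ ?lead_coef_eq0 //.
  by rewrite root_prod_XsubC.
rewrite gE; move: (lead_coef g) => l {gN0 gE rootg} rsP.
rewrite derivZ !hornerZ.
set Q := \prod_(_ <- _) _.
suff QP : Im (Q^`().[z] * (Q.[z])^*) <= 0.
  move: QP; case: (Q^`().[z]) (Q.[z]) l => [a b] [c d] [x y] /= QP.
  rewrite -subr_ge0 [X in 0 <= X](_ : _ = (x ^+ 2 + y ^+ 2) * (- (a * - d + b * c))); last by ring.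
  by rewrite mulr_ge0 ?addr_ge0 ?sqr_ge0 // oppr_ge0.
rewrite {}/Q; elim: rs rsP => [_|r rs IH rsP].
  by rewrite big_nil derivC horner0 mul0r /= lexx.
have := IH (fun s srs => rsP s (mem_behead (s := r :: rs) srs)).
have := rsP r (mem_head _ _).
rewrite big_cons; move: (\prod_(_ <- _) _) => Q.
rewrite derivM derivXsubC !hornerE.
move: (Q^`().[z]) (Q.[z]) => {Q} Q' Q.
case: Q' Q z r {IH rsP} => [a b] [c d] [x y] [u v] /= vy QP.
rewrite -subr_ge0 [X in 0 <= X](_ : _ = (y - v) * (c ^+ 2 + d ^+ 2) +
    ((x - u) ^+ 2 + (y - v) ^+ 2) * (- (a * - d + b * c))); last by ring.
by apply: addr_ge0; apply: mulr_ge0;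
  rewrite ?subr_ge0 ?oppr_ge0 // addr_ge0 ?sqr_ge0.
Qed.

Lemma horner_map_imaginary (p : {poly R}) (t : R) :
  (map_poly toC p).[0 +i* t] =
    (even_poly p).[- t ^+ 2] +i* (t * (odd_poly p).[- t ^+ 2]).
Proof.
have sqE : (0 +i* t) ^+ 2 = toC (- t ^+ 2) by simpc; rewrite !expr2; simpc.
rewrite -[in LHS](poly_even_odd p) rmorphD rmorphM /= !map_comp_poly map_polyXn map_polyX.
rewrite !hornerE !horner_comp !hornerXn sqE !horner_map /=.
by simpc; rewrite [X in _ +i* X]mulrC.
Qed.

(** The imaginary part is [t] times a polynomial in [- t ^+ 2] made of even and odd parts; dividing
    by [t] and letting [t] tend to 0 leaves the Wronskian. *)
Lemma wronskian0_le0 (A B : {poly R}) (e : R) : 0 < e ->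
  (forall t, 0 < t < e ->
     Im ((map_poly toC B).[0 +i* t] * ((map_poly toC A).[0 +i* t])^*) <= 0) ->
  B^`().[0] * A.[0] - B.[0] * A^`().[0] <= 0.
Proof.
move=> e0 ImP.
have val0 (p : {poly R}) : (p.[0] = (even_poly p).[0]) * (p^`().[0] = (odd_poly p).[0]).
  by rewrite !horner_coef0 coef_even_poly coef_odd_poly coef_deriv.
rewrite !(val0 A) !(val0 B) -oppr_ge0.
pose W := (even_poly B * odd_poly A - odd_poly B * even_poly A) \Po (- 'X^2).
have -> : - ((odd_poly B).[0] * (even_poly A).[0] - (even_poly B).[0] * (odd_poly A).[0]) = W.[0].
  by rewrite /W horner_comp !hornerE expr0n /= oppr0; ring.
apply: (horner_ge0_right_limit e0) => t tP; have /andP[t0 _] := tP.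
have := ImP t tP; rewrite !horner_map_imaginary /=.
rewrite /W horner_comp !hornerE /= -oppr_ge0.
rewrite [X in 0 <= X -> _](_ : _ = t * ((even_poly B).[- t ^+ 2] * (odd_poly A).[- t ^+ 2] -
  (odd_poly B).[- t ^+ 2] * (even_poly A).[- t ^+ 2])); last by ring.
by rewrite pmulr_rge0.
Qed.
End ComplexPolynomials.

(** * Restriction of multivariate polynomials to polynomial curves *)

Section Restriction.
Variables (n : nat) (K : comNzRingType).
Implicit Types (p q : {mpoly K[n]}) (w : 'I_n -> {poly K}).

Definition restrict w p : {poly K} := mmap (@polyC K) w p.

Lemma horner_restrict w p c : (restrict w p).[c] = p.@[fun i => (w i).[c]].
Proof.
rewrite /restrict /mmap horner_sum mevalE; apply: eq_bigr => m _.
rewrite hornerM hornerC /mmap1 horner_prod; congr (_ * _).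
by apply: eq_bigr => i _; rewrite horner_exp.
Qed.

(** The chain rule: it passes to sums and products, so constants and variables suffice. *)
Lemma deriv_restrict w p :
  (restrict w p)^`() = \sum_i (w i)^`() * restrict w p^`M(i).
Proof.
pose P q := (restrict w q)^`() = \sum_i (w i)^`() * restrict w q^`M(i).
have PM q1 q2 : P q1 -> P q2 -> P (q1 * q2).
  rewrite /P /restrict => P1 P2; rewrite rmorphM derivM P1 P2 mulr_suml mulr_sumr -big_split.
  by apply: eq_bigr => i _; rewrite mderivM rmorphD !rmorphM /=; ring.
have P1 : P 1.
  rewrite /P /restrict rmorph1 -polyC1 derivC big1 // => i _.
  by rewrite -mpolyC1 mderivC rmorph0 mulr0.
have PX i : P 'X_i.
  rewrite /P /restrict mmapX mmap1U (bigD1 i) //= mderivX mnm1E eqxx.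
  rewrite -[X in (X - _)%MM]add0m addmK mpolyX0 scale1r rmorph1 mulr1 big1 ?addr0 // => j ji.
  by rewrite mderivX mnm1E eq_sym (negPf ji) scale0r rmorph0 mulr0.
rewrite -/(P p); elim/mpolyind: p => [|c m p _ _ Pp].
  by rewrite /P /restrict rmorph0 deriv0 big1 // => i _; rewrite mderiv0 rmorph0 mulr0.
have Pm : P 'X_[m].
  rewrite mpolyXE_id; apply: (big_ind P) => // i _.
  by elim: (m i) => [|k IH]; rewrite ?expr0 // exprS; apply: PM.
move: Pm Pp; rewrite /P /restrict => Pm Pp.
rewrite -mul_mpolyC rmorphD rmorphM /= mmapC derivD Pp derivM derivC mul0r add0r Pm.
rewrite mulr_sumr -big_split; apply: eq_bigr => i _ /=.
by rewrite mderivD mderiv_mulC rmorphD rmorphM /= mmapC; ring.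
Qed.

End Restriction.

Lemma meval_map_mpoly n (K L : comNzRingType) (f : {rmorphism K -> L})
    (p : {mpoly K[n]}) (v : 'I_n -> L) :
  (map_mpoly f p).@[v] = \sum_(m <- msupp p) f p@_m * \prod_i v i ^+ m i.
Proof.
rewrite {1}(mpolyE p) (raddf_sum (map_mpoly f)) raddf_sum; apply: eq_bigr => m _.
by rewrite /= map_mpolyZ mevalZ map_mpolyX mevalX.
Qed.

Lemma mderiv_map_mpoly n (K L : comNzRingType) (f : {rmorphism K -> L})
    (p : {mpoly K[n]}) i : (map_mpoly f p)^`M(i) = map_mpoly f p^`M(i).
Proof.
by apply/mpolyP => m; rewrite mcoeff_map_mpoly !mcoeff_mderiv raddfMn mcoeff_map_mpoly.
Qed.

Lemma horner_map_restrict n (K L : comNzRingType) (f : {rmorphism K -> L})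
    (p : {mpoly K[n]}) w c :
  (map_poly f (restrict w p)).[c] =
  (map_mpoly f p).@[fun i => (map_poly f (w i)).[c]].
Proof.
rewrite meval_map_mpoly /restrict /mmap rmorph_sum horner_sum /=.
apply: eq_bigr => m _; rewrite rmorphM /= map_polyC hornerM hornerC.
rewrite /mmap1 rmorph_prod horner_prod /=; congr (_ * _).
by apply: eq_bigr => i _; rewrite rmorphXn horner_exp.
Qed.

(** * Negative correlation for stable polynomials *)

Section Stable.
Local Open Scope complex_scope.
Variables (R : realType) (n : nat).
Implicit Types (p q : {mpoly R[n]}) (x v : 'I_n -> R).
Local Notation C := R[i].
Local Notation toC := (real_complex R).
Local Notation Im := (@complex.Im R).

(** At [z = x + i t v], stability keeps the roots of [s |-> p(z + s e_j)] out of the upper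
    half-plane, so [Im_logderiv_le0] applies at [s = 0]; as [t] tends to 0 this bounds the
    derivative of [p_j / p] along [v]. *)
Lemma logderiv_decreasing_direction p j x v :
  real_stable p -> (forall k, 0 < v k) ->
  \sum_k v k * (p^`M(j)^`M(k).@[x] * p.@[x] - p^`M(j).@[x] * p^`M(k).@[x]) <= 0.
Proof.
move=> stp v0.
pose w k : {poly R} := (x k)%:P + v k *: 'X.
have w0 q : (restrict w q).[0] = q.@[x].
  by rewrite horner_restrict; apply: meval_eq => k; rewrite !hornerE.
have dw q : (restrict w q)^`().[0] = \sum_k v k * q^`M(k).@[x].
  rewrite deriv_restrict horner_sum; apply: eq_bigr => k _.
  by rewrite hornerM w0 /w !derivE !hornerE.
suff : (restrict w p^`M(j))^`().[0] * (restrict w p).[0] -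
       (restrict w p^`M(j)).[0] * (restrict w p)^`().[0] <= 0.
  apply: le_trans; rewrite !dw !w0 mulr_suml mulr_sumr -sumrB le_eqVlt.
  by apply/orP; left; apply/eqP; apply: eq_bigr => k _; ring.
apply: (@wronskian0_le0 _ _ _ 1) => // t /andP[t0 _].
rewrite !horner_map_restrict -mderiv_map_mpoly.
set z := fun k => _; have Imz k : Im (z k) = t * v k.
  rewrite /z /w rmorphD /= map_polyC map_polyZ map_polyX !hornerE /=; simpc.
  by rewrite /= mulrC.
pose g := restrict (fun k => (z k)%:P + (k == j)%:R *: 'X) (map_mpoly toC p).
have g0 (q : {mpoly C[n]}) : (restrict (fun k => (z k)%:P + (k == j)%:R *: 'X) q).[0] = q.@[z].
  by rewrite horner_restrict; apply: meval_eq => k; rewrite !hornerE.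
have <- : g.[0] = (map_mpoly toC p).@[z] by apply: g0.
have <- : g^`().[0] = (map_mpoly toC p)^`M(j).@[z].
  rewrite /g deriv_restrict horner_sum (bigD1 j) //= big1 ?addr0 => [|k kj].
    by rewrite hornerM g0 !derivE eqxx !hornerE.
  by rewrite (negPf kj) scale0r addr0 derivC mul0r horner0.
apply: Im_logderiv_le0 => r; rewrite leNgt; apply: contraL => r0.
rewrite rootE /g horner_restrict; apply: stp => k; rewrite !hornerE.
rewrite raddfD /= Imz; have := mulr_gt0 t0 (v0 k).
by case: (k == j); rewrite ?mul1r ?mul0r /=; move: r0; rewrite /=; lra.
Qed.

(** The coordinate direction [i] is on the boundary of the positive cone, so [e] is added to all its
    entries and then tends to 0. *)
Lemma stable_rayleigh p i j x : real_stable p ->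
  p^`M(j)^`M(i).@[x] * p.@[x] <= p^`M(j).@[x] * p^`M(i).@[x].
Proof.
move=> stp; rewrite -subr_ge0.
pose c k := p^`M(j).@[x] * p^`M(k).@[x] - p^`M(j)^`M(k).@[x] * p.@[x].
pose g := (c i)%:P + (\sum_k c k) *: 'X.
have -> : p^`M(j).@[x] * p^`M(i).@[x] - p^`M(j)^`M(i).@[x] * p.@[x] = g.[0].
  by rewrite /g !hornerE.
apply: (@horner_ge0_right_limit _ _ 1) => // e /andP[e0 _].
have := @logderiv_decreasing_direction p j x (fun k => (k == i)%:R + e) stp.
have e_gt0 k : 0 < (k == i)%:R + e by rewrite ltr_wpDl.
move=> /(_ e_gt0); rewrite -oppr_ge0 -sumrN; congr (_ <= _).
rewrite /g !hornerE mulr_suml.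
rewrite (eq_bigr (fun k => (k == i)%:R * c k + c k * e)); last first.
  by move=> k _; rewrite /c; ring.
rewrite big_split /=; congr (_ + _).
rewrite (bigD1 i) //= eqxx mul1r big1 ?addr0 // => k ki.
by rewrite (negPf ki) mul0r.
Qed.
End Stable.

(** * The Euler operator and correlation with the homogenizing variable *)

Section Euler.
Local Open Scope complex_scope.
Variables (R : realType) (n : nat).
Implicit Types (p q : {mpoly R[n]}) (x v : 'I_n -> R).
Local Notation C := R[i].
Local Notation toC := (real_complex R).
Local Notation Im := (@complex.Im R).

Lemma prod_near_real (t : R) (z : 'I_n -> C) (x : 'I_n -> R) (m : 'X_{1..n}) :
  0 <= t -> (forall k, 0 <= x k) ->
  (forall k, `|z k - toC (x k)| <= toC (t * x k)) ->
  `|\prod_k z k ^+ m k - toC (\prod_k x k ^+ m k)| <=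
    toC (((1 + t) ^+ mdeg m - 1) * \prod_k x k ^+ m k).
Proof.
move=> t0 x0 near.
(* [a] approximates [b] with relative error [(1 + t) ^+ d - 1]; under products the exponents add. *)
pose Q (d : nat) (a : C) (b : R) :=
  0 <= b /\ `|a - toC b| <= toC (((1 + t) ^+ d - 1) * b).
have QM d1 d2 a1 a2 b1 b2 : Q d1 a1 b1 -> Q d2 a2 b2 -> Q (d1 + d2)%N (a1 * a2) (b1 * b2).
  move=> [b10 near1] [b20 near2]; split; first exact: mulr_ge0.
  have norm2 : `|a2| <= toC ((1 + t) ^+ d2 * b2).
    rewrite -(subrK (toC b2) a2) (le_trans (ler_normD _ _)) //.
    rewrite (le_trans (lerD near2 (lexx _))) // (@ger0_norm _ (toC b2)) ?ler0c //.
    by rewrite -rmorphD lecR; lra.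
  have -> : a1 * a2 - toC (b1 * b2) = (a1 - toC b1) * a2 + toC b1 * (a2 - toC b2).
    by rewrite rmorphM /=; ring.
  rewrite (le_trans (ler_normD _ _)) // !normrM (@ger0_norm _ (toC b1)) ?ler0c //.
  have -> : ((1 + t) ^+ (d1 + d2) - 1) * (b1 * b2) =
    ((1 + t) ^+ d1 - 1) * b1 * ((1 + t) ^+ d2 * b2) + b1 * (((1 + t) ^+ d2 - 1) * b2).
    by rewrite exprD; ring.
  rewrite rmorphD; apply: lerD; rewrite rmorphM; first by rewrite ler_pM.
  by rewrite ler_wpM2l ?ler0c.
have Q1 : Q 0%N 1 1.
  by split; rewrite ?ler01 // expr0 rmorph1 !subrr mul0r normr0 rmorph0.
suff [] : Q (mdeg m) (\prod_k z k ^+ m k) (\prod_k x k ^+ m k) by [].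
rewrite mdegE; apply: (big_rec3 Q) => // k d a b _.
apply: (QM); elim: (m k) => [|e IH] //.
by rewrite -add1n !exprD !expr1; apply: (QM) => //; split=> //; rewrite ?expr1 [1 + t]addrC addrK.
Qed.

(** Nonnegative terms do not cancel, so the relative error of the monomials bounds that of the sum;
    [e] ensures [(1 + t) ^+ d < 2], hence an error below 1. *)
Lemma meval_near_real_neq0 p : (forall m, 0 <= p@_m) ->
  exists2 e : R, 0 < e & forall t (z : 'I_n -> C) (x : 'I_n -> R),
    0 < t < e -> (forall k, 0 <= x k) -> 0 < p.@[x] ->
    (forall k, `|z k - toC (x k)| <= toC (t * x k)) ->
    (map_mpoly toC p).@[z] != 0.
Proof.
move=> p0; have [d dP] : exists d, forall m, m \in msupp p -> (mdeg m <= d)%N.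
  by exists (msize p) => m mp; rewrite ltnW // msize_mdeg_lt.
have [e e0 eP] := poly_cont 0 ((1 + 'X) ^+ d : {poly R}) ltr01.
exists e => // t z x /andP[t0 te] x0 px near; apply/eqP => pz.
have td : (1 + t) ^+ d < 2.
  have valE u : ((1 + 'X) ^+ d : {poly R}).[u] = (1 + u) ^+ d.
    by rewrite horner_exp hornerD hornerX -polyC1 hornerC.
  have := eP t; rewrite subr0 gtr0_norm // => /(_ te).
  rewrite !valE addr0 expr1n => /(le_lt_trans (ler_norm _)).
  by rewrite ltrBlDr.
suff : `|(map_mpoly toC p).@[z] - toC p.@[x]| <= toC (((1 + t) ^+ d - 1) * p.@[x]).
  rewrite pz sub0r normrN ger0_norm ?ler0c ?(ltW px) // lecR.
  by rewrite -[X in X <= _]mul1r ler_pM2r // lerBrDr leNgt td.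
rewrite meval_map_mpoly mevalE rmorph_sum -sumrB mulr_sumr rmorph_sum /=.
apply: le_trans (ler_norm_sum _ _ _) _.
rewrite big_seq [X in _ <= X]big_seq; apply: ler_sum => m mp.
have pr0 : 0 <= \prod_i x i ^+ m i by apply: prodr_ge0 => k _; apply: exprn_ge0.
rewrite rmorphM -mulrBr normrM ger0_norm ?ler0c //.
rewrite mulrCA rmorphM /= ler_wpM2l ?ler0c //.
apply: le_trans (prod_near_real _ (ltW t0) x0 near) _.
rewrite lecR ler_wpM2r // lerD2r ler_weXn2l ?dP //.
by rewrite lerDl ltW.
Qed.

(** This operator multiplies each monomial by its total degree in the variables of [T]. *)
Definition euler (T : {pred 'I_n}) p : {mpoly R[n]} := \sum_(k in T) 'X_k * p^`M(k).

Lemma meval_euler T p x : (euler T p).@[x] = \sum_(k in T) x k * p^`M(k).@[x].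
Proof.
by rewrite /euler (raddf_sum (meval x)); apply: eq_bigr => k _; rewrite /= mevalM mevalXU.
Qed.

(* For the homogenization of [p] this is [stable_rayleigh] for the pair formed
   by [i] and the homogenizing variable. The roots of [s |-> p(s z)] lying near
   the positive reals, which stability does not control, are excluded by
   positivity of the coefficients. *)
Lemma stable_rayleigh_degree p i x (E := euler predT p) :
  real_stable p -> (forall m, 0 <= p@_m) ->
  (forall y, (forall k, 0 < y k) -> 0 < p.@[y]) -> (forall k, 0 < x k) ->
  E.@[x] * p^`M(i).@[x] <= E^`M(i).@[x] * p.@[x].
Proof.
move=> stp p0 ppos x0.
(* Coordinate [i] moves downwards, so the Wronskian bound yields the inequality opposite to
   [stable_rayleigh]. *)
pose w k : {poly R} := x k *: (1 - (k == i)%:R *: 'X).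
have w0 q : (restrict w q).[0] = q.@[x].
  rewrite horner_restrict; apply: meval_eq => k.
  by rewrite /w !hornerE /=; ring.
have dw q : (restrict w q)^`().[0] = - x i * q^`M(i).@[x].
  rewrite deriv_restrict horner_sum (bigD1 i) //= big1 ?addr0 => [|k ki].
    by rewrite hornerM w0 /w !derivE eqxx !hornerE /=; ring.
  by rewrite /w (negPf ki) scale0r subr0 derivZ derivC scaler0 mul0r horner0.
suff : (restrict w E)^`().[0] * (restrict w p).[0] -
       (restrict w E).[0] * (restrict w p)^`().[0] <= 0.
  rewrite !dw !w0 -oppr_ge0 => W.
  rewrite -subr_ge0 -(pmulr_rge0 _ (x0 i)); apply: le_trans W _.
  by rewrite le_eqVlt; apply/orP; left; apply/eqP; ring.
have [e e0 nearP] := meval_near_real_neq0 p0.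
apply: (@wronskian0_le0 _ _ _ e) => // t te; have /andP[t0 _] := te.
rewrite !horner_map_restrict.
set z := fun k => _; have zE k : z k = toC (x k) * (1 - (k == i)%:R * (0 +i* t)).
  rewrite /z /w map_polyZ rmorphB rmorph1 /= map_polyZ map_polyX rmorph_nat.
  by rewrite !hornerE.
pose g := restrict (fun k => z k *: 'X) (map_mpoly toC p).
have g1 (q : {mpoly C[n]}) : (restrict (fun k => z k *: 'X) q).[1] = q.@[z].
  by rewrite horner_restrict; apply: meval_eq => k; rewrite !hornerE.
have gE : g^`().[1] = (map_mpoly toC E).@[z].
  rewrite /g deriv_restrict horner_sum /E /euler.
  rewrite (raddf_sum (map_mpoly toC)) (raddf_sum (meval z)) /=.
  apply: eq_bigr => k _; rewrite hornerM g1 !derivE !hornerE.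
  by rewrite rmorphM /= map_mpolyX mevalM mevalXU mderiv_map_mpoly.
suff : Im (g^`().[1] * (g.[1])^*) <= 0 by rewrite gE g1.
apply: Im_logderiv_le0 => -[a b]; rewrite /= leNgt; apply: contraL => b0.
rewrite rootE /g horner_restrict.
have rzE k : (z k *: 'X).[a +i* b] = toC (x k) *
    (if k == i then (a + t * b) +i* (b - t * a) else a +i* b).
  rewrite !hornerE zE; case: (k == i); simpc => //=.
  by congr (_ +i* _); ring.
(* For a root candidate [s = a + i b]: if [t * a < b], all [s z_k] lie in the upper half-plane;
   otherwise they are within relative error [t] of positive reals. *)
have [ltab|leab] := ltrP (t * a) b.
  apply: stp => k; rewrite rzE; case: (k == i) => /=; simpc; rewrite /= mulr_gt0 //.
  by rewrite subr_gt0.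
have a0 : 0 < a by rewrite -(pmulr_rgt0 _ t0) (lt_le_trans b0).
pose y k := x k * (if k == i then a + t * b else a).
have y0 k : 0 < y k.
  by rewrite mulr_gt0 //; case: (k == i) => //; rewrite addr_gt0 // mulr_gt0.
apply: (nearP t _ y te) => [k||k]; first exact: ltW.
  exact: ppos.
rewrite rzE /y rmorphM -mulrBr normrM ger0_norm ?ler0c ?(ltW (x0 k)) //.
rewrite (mulrCA t) [X in _ <= X]rmorphM; apply: ler_wpM2l; first by rewrite ler0c ltW.
have imN (u v : R) : `|u +i* v - toC u| = toC `|v|.
  rewrite normc_def; congr (toC _).
  by rewrite -sqrtr_sqr; congr Num.sqrt; rewrite /=; ring.
case: (k == i); rewrite imN lecR; last by rewrite gtr0_norm.
rewrite ler0_norm ?subr_le0 //.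
have := mulr_gt0 t0 (mulr_gt0 t0 b0); lra.
Qed.
End Euler.

(** * Monotonicity of mean degrees *)

Section Tilting.
Variables (R : realType) (n : nat).
Implicit Types (p q : {mpoly R[n]}) (x y : 'I_n -> R) (T : {pred 'I_n}).

Lemma meval_gt0 p x : (forall m, 0 <= p@_m) -> p != 0 ->
  (forall k, 0 < x k) -> 0 < p.@[x].
Proof.
move=> p0 pN0 x0.
have pr0 (m : 'X_{1..n}) : 0 < \prod_i x i ^+ m i.
  by apply: prodr_gt0 => i _; apply: exprn_gt0.
rewrite mevalE lt_def sumr_ge0 ?andbT => [|m _]; last by rewrite mulr_ge0 // ltW.
rewrite psumr_eq0 => [|m _]; last by rewrite mulr_ge0 // ltW.
apply/allPn; exists (mlead p); first exact: mlead_supp.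
by rewrite /= mulf_neq0 ?(gt_eqF (pr0 _)) // mleadc_eq0.
Qed.

Lemma meval_mderiv_euler T p x i :
  (euler T p)^`M(i).@[x] =
    \sum_(k in T) ((k == i)%:R * p^`M(k).@[x] + x k * p^`M(k)^`M(i).@[x]).
Proof.
rewrite /euler (raddf_sum (mderiv i)) (raddf_sum (meval x)).
apply: eq_bigr => k _ /=; rewrite mderivM mevalD !mevalM mevalXU mderivX mevalZ mnm1E.
congr (_ + _); case: eqVneq => [->|_]; last by rewrite !mul0r.
by rewrite -[X in (X - _)%MM]add0m addmK mpolyX0 meval1 mulr1.
Qed.

Variable p : {mpoly R[n]}.
Hypotheses (p_stable : real_stable p) (p_ge0 : forall m, 0 <= p@_m) (p_neq0 : p != 0).

Let p_gt0 x : (forall k, 0 < x k) -> 0 < p.@[x].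
Proof. exact: meval_gt0. Qed.

(** Differentiating the factors ['X_k] gives nothing for [i] outside [T]; the rest is
    [stable_rayleigh] summed over [T]. *)
Lemma euler_rayleigh_notin T x i : (forall k, 0 < x k) -> i \notin T ->
  (euler T p)^`M(i).@[x] * p.@[x] <= (euler T p).@[x] * p^`M(i).@[x].
Proof.
move=> x0 iT; rewrite meval_mderiv_euler meval_euler !mulr_suml.
apply: ler_sum => k kT; have /negPf -> : k != i by apply: contraNneq iT => <-.
by rewrite mul0r add0r -!mulrA ler_pM2l // stable_rayleigh.
Qed.

(** Subtract the bound for the complement of [T] from the one for the full degree. *)
Lemma euler_rayleigh_in T x i : (forall k, 0 < x k) -> i \in T ->
  (euler T p).@[x] * p^`M(i).@[x] <= (euler T p)^`M(i).@[x] * p.@[x].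
Proof.
move=> x0 iT.
have splitE : euler predT p = euler T p + euler (predC T) p.
  by rewrite /euler (bigID (mem T)) /=; congr (_ + _); apply: eq_bigl.
have := stable_rayleigh_degree i p_stable p_ge0 p_gt0 x0.
have := @euler_rayleigh_notin (predC T) x i x0; rewrite inE /= negbK => /(_ iT).
by rewrite splitE mderivD !mevalD !mulrDl; lra.
Qed.

(* [(euler T p).@[x] / p.@[x]] is the mean of the total degree in the variables
   of [T] under the law with weights [p@_m x^m / p.@[x]]. *)
Lemma euler_mean_monotone T x y :
  (forall k, 0 < x k) -> (forall k, 0 < y k) ->
  (forall k, if k \in T then x k <= y k else y k <= x k) ->
  (euler T p).@[x] * p.@[y] <= (euler T p).@[y] * p.@[x].
Proof.
move=> x0 y0 xy.
pose w k : {poly R} := (x k)%:P + (y k - x k) *: 'X.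
pose z c k := x k + (y k - x k) * c.
have wE q c : (restrict w q).[c] = q.@[z c].
  by rewrite horner_restrict; apply: meval_eq => k; rewrite /w !hornerE.
have z0 q : q.@[z 0] = q.@[x] by apply: meval_eq => k; rewrite /z mulr0 addr0.
have z1 q : q.@[z 1] = q.@[y] by apply: meval_eq => k; rewrite /z; ring.
rewrite -!z0 -!z1 -!wE; apply: quotient_nondecreasing => // c /andP[c0 c1].
  rewrite wE; apply: p_gt0 => k; rewrite /z.
  by have := x0 k; have := y0 k; nra.
have zc k : 0 < z c k by rewrite /z; have := x0 k; have := y0 k; nra.
have dw q : (restrict w q)^`().[c] = \sum_k (y k - x k) * q^`M(k).@[z c].
  rewrite deriv_restrict horner_sum; apply: eq_bigr => k _.
  by rewrite hornerM wE /w !derivE !hornerE.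
rewrite !dw !wE mulr_suml mulr_sumr -sumrB; apply: sumr_ge0 => k _.
(* Each increment [y k - x k] multiplies a Rayleigh difference of the same sign. *)
rewrite [X in 0 <= X](_ : _ = (y k - x k) * ((euler T p)^`M(k).@[z c] * p.@[z c] -
  (euler T p).@[z c] * p^`M(k).@[z c])); last by ring.
have := xy k; case: ifPn => kT le_xy.
  by rewrite mulr_ge0 ?subr_ge0 // euler_rayleigh_in.
by rewrite mulr_le0 ?subr_le0 // euler_rayleigh_notin.
Qed.

End Tilting.

(** * Factorization of real-rooted polynomials *)

Lemma real_rooted_prod_XsubC (R : rcfType) (f : {poly R}) :
  (forall z, root (map_poly (real_complex R) f) z -> complex.Im z = 0) ->
  exists rs : seq R, f = lead_coef f *: \prod_(r <- rs) ('X - r%:P).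
Proof.
move=> real_roots; have [-> |fN0] := eqVneq f 0.
  by exists [::]; rewrite lead_coef0 scale0r.
pose fC := map_poly (real_complex R) f.
have fCN0 : fC != 0 by rewrite map_poly_eq0.
have [zs fE] := closed_field_poly_normal fC.
exists [seq complex.Re z | z <- zs].
apply: (map_poly_inj (real_complex R)).
rewrite map_polyZ rmorph_prod big_map -lead_coef_map {1}[map_poly _ f]fE; congr (_ *: _).
rewrite big_seq [RHS]big_seq; apply: eq_bigr => z zzs.
rewrite rmorphB /= map_polyX map_polyC; congr (_ - _%:P).
have : root fC z by rewrite fE rootZ ?lead_coef_eq0 // root_prod_XsubC.
by move/real_roots; case: z {zzs} => a b /= ->.
Qed.

(** * Tilting estimates and the capacity bound *)

Section Capacity.
Variables (R : realType) (n : nat) (p : {mpoly R[n]}).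
Hypotheses (p_stable : real_stable p) (p_ge0 : forall m, 0 <= p@_m) (p_neq0 : p != 0).
Implicit Types (x y : 'I_n -> R) (S T : {pred 'I_n}).

Let p_gt0 x : (forall k, 0 < x k) -> 0 < p.@[x].
Proof. exact: meval_gt0. Qed.

(** Stability excludes roots in the upper half-plane; conjugation excludes the lower one. *)
Lemma restrict_real_rooted (x v : 'I_n -> R) : (forall k, 0 < v k) ->
  forall z, root (map_poly (real_complex R) (restrict (fun k => (x k)%:P + v k *: 'X) p)) z ->
  complex.Im z = 0.
Proof.
move=> v0; set f := restrict _ p.
have upper z : root (map_poly (real_complex R) f) z -> complex.Im z <= 0.
  rewrite leNgt; apply: contraL => z0.
  rewrite rootE horner_map_restrict; apply: p_stable => k.
  rewrite rmorphD /= map_polyC map_polyZ map_polyX !hornerE.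
  by case: z z0 => a b /= b0; simpc; rewrite /= mulr_gt0.
move=> z rz; apply/eqP; rewrite eq_le upper //=.
have : root (map_poly (real_complex R) f) z^*%C.
  rewrite -complex_root_conj -map_poly_comp.
  by rewrite (eq_map_poly (g := real_complex R)) // => a /=; rewrite oppr0.
by move/upper; case: (z) => a b /=; rewrite oppr_le0.
Qed.

(* Along the perturbed curve, which also moves the coordinates outside [S] at
   speed [e], stability applies and gives real roots. *)
Lemma tilt_ge_perturbed S x (c d e : R) (K : nat) :
  (forall k, 0 < x k) -> 0 < c -> 0 <= d < 1 -> 0 < e < 1 ->
  let s := (euler S p).@[x] + e * (euler (predC S) p).@[x] in
  (1 <= c /\ (K%:R - d) * p.@[x] <= s) \/ (c <= 1 /\ s <= (K%:R + d) * p.@[x]) ->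
  (1 - d) * c ^+ K * p.@[x] <=
    p.@[fun k => x k * (if k \in S then c else 1 + e * (c - 1))].
Proof.
move=> x0 c0 d01 /andP[e0 e1] s cond.
pose u k : R := if k \in S then 1 else e.
have u0 k : 0 < u k by rewrite /u; case: ifP.
have u1 k : u k <= 1 by rewrite /u; case: ifP => // _; exact: ltW.
(* The curve is at [x] for [t = 1] and at the target for [t = c]; [u k <= 1] keeps it positive for
   all [t > 0]. *)
pose w k : {poly R} := (x k * (1 - u k))%:P + (x k * u k) *: 'X.
pose f := restrict w p.
have fE t : f.[t] = p.@[fun k => x k * (1 + u k * (t - 1))].
  rewrite horner_restrict; apply: meval_eq => k; rewrite /w !hornerE /=; ring.
have f1 : f.[1] = p.@[x].
  by rewrite fE; apply: meval_eq => k; rewrite subrr mulr0 addr0 mulr1.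
have df1 : f^`().[1] = s.
  rewrite deriv_restrict horner_sum /s !meval_euler (bigID (mem S)) /= mulr_sumr.
  have wE q : (restrict w q).[1] = q.@[x].
    by rewrite horner_restrict; apply: meval_eq => k; rewrite /w !hornerE /=; ring.
  have dE k : ((w k)^`() * restrict w p^`M(k)).[1] = u k * (x k * p^`M(k).@[x]).
    by rewrite hornerM wE /w !derivE !hornerE /=; ring.
  by congr (_ + _); apply: eq_bigr => k kS; rewrite dE /u ?kS ?(negPf kS) ?mul1r.
have fpos t : 0 < t -> 0 < f.[t].
  move=> t0; rewrite fE; apply: p_gt0 => k; rewrite mulr_gt0 //.
  by have := u0 k; have := u1 k; nra.
have [|rs fprod] := @real_rooted_prod_XsubC R f.
  by apply: restrict_real_rooted => k; rewrite mulr_gt0.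
have rs_le0 : all (fun r => r <= 0) rs.
  apply/allP => r rrs; rewrite leNgt; apply/negP => /fpos; rewrite fprod hornerZ.
  have /rootP-> : root (\prod_(r <- rs) ('X - r%:P)) r by rewrite root_prod_XsubC.
  by rewrite mulr0 ltxx.
have [m [g g01 [dQ leQ]]] := prod_nonpos_roots_ge rs_le0.
have Q1 := prod_nonpos_roots_gt0 rs_le0.
move: fprod dQ leQ Q1; set Q := \prod_(_ <- _) _; set l := lead_coef f => fprod dQ leQ Q1.
have l0 : 0 < l by have := fpos 1 ltr01; rewrite fprod hornerZ pmulr_lgt0.
have px0 : 0 < p.@[x] by apply: p_gt0.
have sE : s = (m%:R + g) * p.@[x].
  by rewrite -df1 -f1 fprod derivZ !hornerZ dQ mulrCA.
have cond' : (1 <= c /\ K%:R - d <= m%:R + g) \/ (c <= 1 /\ m%:R + g <= K%:R + d).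
  by move: cond; rewrite sE !ler_pM2r.
have := near_integer_power_ge g01 d01 c0 cond'.
rewrite -(ler_pM2r px0) => /le_trans; apply.
have -> : p.@[fun k => x k * (if k \in S then c else 1 + e * (c - 1))] = f.[c].
  rewrite fE; apply: meval_eq => k; congr (_ * _).
  by rewrite /u; case: ifP => // _; ring.
rewrite mulrC -f1 fprod !hornerZ -mulrA ler_pM2l //.
by apply: leQ; exact: ltW.
Qed.

(** The coordinates outside [S] add [e * b] to the perturbed mean; enlarging [d] to [d + e * b]
    absorbs this, and then [e] tends to 0. *)
Lemma tilt_ge S x (c d : R) (K : nat) :
  (forall k, 0 < x k) -> 0 < c -> 0 <= d < 1 ->
  let s := (euler S p).@[x] in
  (1 <= c /\ (K%:R - d) * p.@[x] <= s) \/ (c <= 1 /\ s <= (K%:R + d) * p.@[x]) ->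
  (1 - d) * c ^+ K * p.@[x] <= p.@[fun k => x k * (if k \in S then c else 1)].
Proof.
move=> x0 c0 /andP[d0 d1] s cond.
have px0 : 0 < p.@[x] by apply: p_gt0.
have [b b0 bE] : exists2 b, 0 <= b & (euler (predC S) p).@[x] = b * p.@[x].
  exists ((euler (predC S) p).@[x] / p.@[x]); last by rewrite divfK ?gt_eqF.
  rewrite divr_ge0 ?(ltW px0) // meval_euler sumr_ge0 // => k _.
  rewrite mulr_ge0 ?(ltW (x0 k)) // mevalE sumr_ge0 // => m _.
  rewrite mulr_ge0 //; first by rewrite mcoeff_mderiv mulrn_wge0.
  by apply: prodr_ge0 => j _; rewrite exprn_ge0 // ltW.
pose w k : {poly R} := if k \in S then (x k * c)%:P else (x k)%:P + (x k * (c - 1)) *: 'X.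
pose g := restrict w p - (c ^+ K * p.@[x]) *: ((1 - d)%:P - b *: 'X).
have gE e : g.[e] = p.@[fun k => x k * (if k \in S then c else 1 + e * (c - 1))]
    - (1 - (d + e * b)) * c ^+ K * p.@[x].
  rewrite /g hornerD hornerN horner_restrict; congr (_ - _).
    by apply: meval_eq => k; rewrite /w; case: ifP => _; rewrite !hornerE //=; ring.
  by rewrite !hornerE /=; ring.
suff : 0 <= g.[0].
  rewrite gE subr_ge0 mul0r addr0 => /le_trans; apply.
  rewrite le_eqVlt; apply/orP; left; apply/eqP; apply: meval_eq => k.
  by rewrite mul0r addr0.
(* Below this bound [d + e * b < 1]; [b + 1] avoids dividing by 0. *)
pose e0 := Num.min 1 ((1 - d) / (b + 1)).
have b1 : 0 < b + 1 by lra.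
have e0_gt0 : 0 < e0 by rewrite lt_min ltr01 divr_gt0 ?subr_gt0.
apply: (horner_ge0_right_limit e0_gt0) => e /andP[e_gt0].
rewrite lt_min ltr_pdivlMr // => /andP[e1 ed].
rewrite gE subr_ge0; apply: tilt_ge_perturbed => //.
- by apply/andP; split; nra.
- by rewrite e_gt0 e1.
- have ebp : 0 <= e * b * p.@[x] by rewrite !mulr_ge0 // ltW.
  by case: cond => -[c1 cond]; [left|right]; split=> //; rewrite bE; move: cond ebp;
    rewrite -/s; lra.
Qed.

Variable kappa : 'I_n -> nat.
Variable d : R.
Hypothesis p1 : p.@[all_ones] = 1.
Hypothesis d01 : 0 <= d < 1.
Hypothesis mean_close : forall T,
  `|(\sum_(k in T) kappa k)%:R - (euler T p).@[all_ones]| <= d.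

(* Induction on the number of coordinates different from [1]: all coordinates
   above [1] are first divided by the smallest of them. By monotonicity of the
   means, undoing this is a tilt to which [tilt_ge] applies. *)
Lemma capacity_ge_card (N : nat) x : (forall k, 0 < x k) ->
  (#|[pred k | x k != 1%R]| <= N)%N ->
  (1 - d) ^+ N * \prod_k x k ^+ kappa k <= p.@[x].
Proof.
have /andP[d0 d1] := d01.
have at_ones M y : (forall k, y k = 1) ->
    (1 - d) ^+ M * \prod_k y k ^+ kappa k <= p.@[y].
  move=> y1; rewrite (meval_eq (v2 := all_ones)) // p1 big1 => [|k _].
    by rewrite mulr1 exprn_ile1 // ?subr_ge0 ?(ltW d1) // lerBlDr lerDl.
  by rewrite y1 expr1n.
elim: N x => [|N IH] x x0.
  rewrite leqn0 => /eqP/card0_eq x1; apply: at_ones => k.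
  by apply/eqP; have := x1 k; rewrite !inE => /negbFE.
move=> cardN.
(* Shared by both directions: [i0] becomes 1 in [x'], no coordinate leaves 1, and [tilt_ge] costs
   one factor [1 - d]. *)
have peel S (c : R) i0 : 0 < c -> i0 \in S -> x i0 = c ->
    (forall k, k \in S -> x k != 1) ->
    let x' k := if k \in S then x k / c else x k in
    (1 <= c /\ (euler S p).@[all_ones] * p.@[x'] <= (euler S p).@[x']) \/
    (c <= 1 /\ (euler S p).@[x'] <= (euler S p).@[all_ones] * p.@[x']) ->
    (1 - d) ^+ N.+1 * \prod_k x k ^+ kappa k <= p.@[x].
  move=> c0 i0S xi0 S1 x' cond.
  have x'0 k : 0 < x' k by rewrite /x'; case: ifP => // _; rewrite divr_gt0.
  have px' : 0 < p.@[x'] by apply: p_gt0.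
  have x'N1 k : x' k != 1 -> x k != 1.
    by rewrite /x'; case: ifP => // kS _; exact: S1.
  have card' : (#|[pred k | x' k != 1%R]| <= N)%N.
    rewrite -ltnS; apply: leq_trans cardN; apply: proper_card.
    apply/properP; split; first by apply/fintype.subsetP => k; rewrite !inE; apply: x'N1.
    by exists i0; rewrite !inE ?S1 // /x' i0S xi0 divff ?(gt_eqF c0) // eqxx.
  pose K := (\sum_(k in S) kappa k)%N.
  have tilt : (1 - d) * c ^+ K * p.@[x'] <= p.@[x].
    have -> : p.@[x] = p.@[fun k => x' k * (if k \in S then c else 1)].
      apply: meval_eq => k; rewrite /x'; case: ifP => _; last by rewrite mulr1.
      by rewrite divfK ?gt_eqF.
    apply: tilt_ge => //.
    have := mean_close S; rewrite -/K ler_distl => /andP[lo hi].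
    by case: cond => -[c1 cond]; [left|right]; split=> //;
      [apply: le_trans cond|apply: (le_trans cond)]; rewrite ler_pM2r //; lra.
  apply: le_trans tilt.
  have -> : \prod_k x k ^+ kappa k = c ^+ K * \prod_k x' k ^+ kappa k.
    rewrite /K -prodrXr [in X in _ = X * _](big_mkcond) -big_split /=.
    apply: eq_bigr => k _; rewrite /x'; case: ifP => _; last by rewrite mul1r.
    by rewrite -exprMn mulrC divfK ?gt_eqF.
  rewrite exprS -!mulrA ler_pM2l ?subr_gt0 // mulrCA ler_pM2l ?exprn_gt0 //.
  exact: IH.
have ones0 (k : 'I_n) : 0 < all_ones k :> R by exact: ltr01.
have mono := euler_mean_monotone p_stable p_ge0 p_neq0.
have [/existsP[j xj1]|noUp] := boolP [exists k, 1 < x k].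
  (* Dividing by the value nearest to 1 keeps [x'] at least 1 on [S] and at most 1 elsewhere, so
     [mono] compares its mean with that at [all_ones]. *)
  have [i0 /= xi0 minP] := arg_minP (P := fun k => 1 < x k) x xj1.
  apply: (peel [pred k | 1 < x k] (x i0) i0) => // [k|].
    by rewrite inE => /gt_eqF->.
  left; split; first exact: ltW.
  rewrite -[X in _ <= X]mulr1 -[X in _ <= _ * X]p1; apply: mono => // k; rewrite inE.
    by case: ifP => _ //; rewrite divr_gt0.
  case: (boolP (1 < x k)) => [/minP le_x|]; last by rewrite -leNgt.
  by rewrite ler_pdivlMr // mul1r.
have [/existsP[j xj1]|noDown] := boolP [exists k, x k < 1].
  have [i0 /= xi0 maxP] := arg_maxP (P := fun k => x k < 1) x xj1.
  apply: (peel [pred k | x k < 1] (x i0) i0) => // [k|].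
    by rewrite inE => /lt_eqF->.
  right; split; first exact: ltW.
  rewrite -[X in X <= _]mulr1 -[X in _ * X <= _]p1; apply: mono => // k; rewrite inE.
    by case: ifP => _ //; rewrite divr_gt0.
  case: (boolP (x k < 1)) => [/maxP ge_x|]; last by rewrite -leNgt.
  by rewrite ler_pdivrMr // mul1r.
apply: at_ones => k; apply/eqP; rewrite eq_le.
have := noUp; have := noDown; rewrite !negb_exists.
by move=> /forallP/(_ k) + /forallP/(_ k); rewrite -!leNgt => -> ->.
Qed.
End Capacity.

Theorem theorem2p3 (R : realType) (n : nat) (p : {mpoly R[n]})
    (kappa : 'I_n -> int) :
  (1 <= n)%N ->
  real_stable p ->
  (forall m : 'X_{1..n}, 0 <= p@_m) ->
  (forall i, 0 <= kappa i) ->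
  p.@[all_ones] = 1 ->
  norm1 (fun i => (kappa i)%:~R - gradient p all_ones i) < 1 ->
  inf [set y : R | exists x : 'I_n -> R,
         (forall i, 0 < x i) /\ y = p.@[x] / \prod_(i < n) x i ^ kappa i]%classic
  >= (1 - norm1 (fun i => (kappa i)%:~R - gradient p all_ones i)) ^+ n.
Proof.
move=> _ p_stable p_ge0 kappa_ge0 p1; set d := norm1 _ => d1.
have kappaE i : kappa i = `|kappa i|%N by rewrite gez0_abs.
have p_neq0 : p != 0.
  by apply/eqP => p0; move: p1; rewrite p0 meval0 => /esym/eqP; rewrite oner_eq0.
have d0 : 0 <= d by apply: sumr_ge0 => i _; exact: normr_ge0.
(* By the triangle inequality, one [d] serves every level set [T]. *)
have close (T : {pred 'I_n}) :
    `|(\sum_(k in T) `|kappa k|%N)%:R - (euler T p).@[all_ones]| <= d.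
  rewrite natr_sum meval_euler -sumrB (le_trans (ler_norm_sum _ _ _)) //.
  rewrite /d /norm1 [X in _ <= X](bigID (mem T)) /= ler_wpDr ?sumr_ge0 //.
  apply: ler_sum => k _; rewrite /gradient mul1r [kappa k in X in _ <= X]kappaE.
  by rewrite -pmulrn.
apply: lb_le_inf.
  by exists (p.@[all_ones] / \prod_(i < n) all_ones i ^ kappa i); exists all_ones.
move=> _ [x [x0 ->]].
have prod_gt0 : 0 < \prod_(i < n) x i ^ kappa i.
  by apply: prodr_gt0 => i _; exact: exprz_gt0.
rewrite ler_pdivlMr //.
have -> : \prod_(i < n) x i ^ kappa i = \prod_(i < n) x i ^+ `|kappa i|%N.
  by apply: eq_bigr => i _; rewrite {1}kappaE.
apply: capacity_ge_card => //; first by rewrite d0.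
by apply: leq_trans (max_card _) _; rewrite card_ord.
Qed.
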